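(* Let $\alpha\in(0,2]$ and $\nu>0$. Let $X_1,X_2,\ldots$ be independent identically distributed random variables such that $$\frac{1}{n^{1/\alpha}}\sum_{i=1}^n X_i\Longrightarrow S_{\alpha,0}\quad (n\to\infty).$$ For each $n\in\mathbb{N}$ let $N_n$ be a random variable, independent of $X_1,X_2,\ldots$, having the negative binomial distribution with parameters $\nu$ and $p=1/n$. Then $$\frac{1}{n^{1/\alpha}}\sum_{i=1}^{N_n}X_i\Longrightarrow L_{\alpha,\nu}\quad(n\to\infty).$$
   Context: $\Longrightarrow$ denotes convergence in distribution. $S_{\alpha,0}$ denotes a symmetric strictly stable random variable with characteristic function $e^{-|t|^\alpha}$. The negative binomial distribution with parameters $\nu>0$, $p\in(0,1)$ is given by $\mathsf{P}(N=k)=\frac{\Gamma(\nu+k-1)}{(k-1)!\,\Gamma(\nu)}p^\nu(1-p)^{k-1}$, $k=1,2,\ldots$. $L_{\alpha,\nu}$ denotes a random variable with characteristic function $(1+|t|^{\alpha})^{-\nu}$, $t\in\mathbb{R}$. *)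

(* Defs.v *)
From HB Require Import structures.
From mathcomp Require Import all_boot all_order all_algebra.
From mathcomp Require Import all_classical all_reals all_analysis.
Set Implicit Arguments. Unset Strict Implicit. Unset Printing Implicit Defensive.
Import Order.TTheory GRing.Theory Num.Theory.
Import numFieldNormedType.Exports.
Local Open Scope classical_set_scope.
Local Open Scope ring_scope.

(* Mutual independence of a sequence of real random variables: product rule
   for every finite initial segment of indices and every family of Borel sets
   (unused indices can be given the set setT, so this covers every finite
   subfamily). *)
Definition mutually_independent_seq d (T : measurableType d) (R : realType)
  (P : probability T R) (X : nat -> {RV P >-> R}) : Prop :=
  forall (m : nat) (B : nat -> set R), (forall i, measurable (B i)) ->
    P (\bigcap_(i in `I_m) (X i @^-1` B i)) = (\prod_(i < m) P (X i @^-1` B i))%E.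

Definition identically_distributed d (T : measurableType d) (R : realType)
  (P : probability T R) (X : nat -> {RV P >-> R}) : Prop :=
  forall i (B : set R), measurable B -> P (X i @^-1` B) = P (X 0%N @^-1` B).

Definition indep_of_seq d (T : measurableType d) (R : realType)
  (P : probability T R) (N : T -> nat) (X : nat -> {RV P >-> R}) : Prop :=
  forall (A : set nat) (m : nat) (B : nat -> set R), (forall i, measurable (B i)) ->
    P (N @^-1` A `&` \bigcap_(i in `I_m) (X i @^-1` B i))
    = (P (N @^-1` A) * P (\bigcap_(i in `I_m) (X i @^-1` B i)))%E.

(* Negative binomial law with parameters nu > 0, p in (0,1), on {1,2,...}:
   P(N = k) = Gamma(nu+k-1) / ((k-1)! Gamma(nu)) p^nu (1-p)^(k-1).
   The Gamma ratio Gamma(nu+k-1)/Gamma(nu) is written as the rising factorial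
   prod_{j<k-1} (nu + j) (the Gamma function is not in the library). *)
Definition negbin_pmf (R : realType) (nu p : R) (k : nat) : R :=
  ((\prod_(j < k.-1) (nu + j%:R)) / (k.-1)`!%:R) * (p `^ nu) * (1 - p) ^+ k.-1.

Definition is_negbin d (T : measurableType d) (R : realType)
  (P : probability T R) (N : T -> nat) (nu p : R) : Prop :=
  forall k : nat, (0 < k)%N -> P (N @^-1` [set k]) = (negbin_pmf nu p k)%:E.

Definition has_charfun (R : realType) (mu : probability R R) (phi : R -> R) : Prop :=
  forall t : R,
    (\int[mu]_x (cos (t * x))%:E = (phi t)%:E)%E /\
    (\int[mu]_x (sin (t * x))%:E = 0)%E.

Definition conv_in_distr d (T : measurableType d) (R : realType)
  (P : probability T R) (Y : nat -> T -> R) (mu : probability R R) : Prop :=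
  forall f : R -> R, continuous f -> (exists M : R, forall x, `|f x| <= M) ->
    ((fun n => \int[P]_w (f (Y n w))%:E) @ \oo --> \int[mu]_x (f x)%:E)%E.

(* Main.v *)
Require Import Defs.
From HB Require Import structures.
From mathcomp Require Import all_boot all_order all_algebra.
From mathcomp Require Import all_classical all_reals all_analysis.
From mathcomp Require Import measurable_realfun ring lra.
Set Implicit Arguments.
Unset Strict Implicit.
Unset Printing Implicit Defensive.
Import Order.TTheory GRing.Theory Num.Theory.
Import numFieldNormedType.Exports.
Local Open Scope classical_set_scope.
Local Open Scope ring_scope.

(* The negative binomial law with p = 1/n is the mixture over x, distributed
   according to the gamma law with Laplace transform (1 + s)^-nu, of the law
   of 1 + Poisson((n-1)x). Given x, Chebyshev's inequality makes N_n/n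
   concentrate at x, so that the normalized random sum behaves like
   x^(1/alpha) S, uniformly enough because its conditioning on N_n = k is
   (k/n)^(1/alpha) times a normalized sum of k terms. Dominated convergence in
   x then gives the limit law, that of x^(1/alpha) S with x and S independent;
   its characteristic function is the Laplace transform of x at |t|^alpha. *)

Section density_measure.
Local Open Scope ereal_scope.
Context d (T : measurableType d) (R : realType).
Variables (mu : {measure set T -> \bar R}) (w : T -> R).
Hypotheses (w_ge0 : forall x, (0 <= w x)%R) (mw : measurable_fun setT w).

Definition density_measure of (forall x, (0 <= w x)%R) & measurable_fun setT w :=
  fun A : set T => \int[mu]_(x in A) (w x)%:E.

Local Notation nu := (density_measure w_ge0 mw).

Let nu0 : nu set0 = 0.
Proof. exact: integral_set0. Qed.

Let nu_ge0 A : 0 <= nu A.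
Proof. by apply: integral_ge0 => x _; rewrite lee_fin. Qed.

Let nu_sigma_additive : semi_sigma_additive nu.
Proof.
move=> F mF tF mUF; apply: cvg_toP.
  by apply: ereal_nondecreasing_is_cvgn => m n mn; exact: lee_sum_nneg_natr.
rewrite /density_measure ge0_integral_bigcup//=.
  exact/measurable_EFinP/measurable_funTS.
by move=> x _; rewrite lee_fin.
Qed.

HB.instance Definition _ :=
  isMeasure.Build _ _ _ nu nu0 nu_ge0 nu_sigma_additive.

Import HBNNSimple.

Lemma ge0_integral_density (f : T -> \bar R) :
  measurable_fun setT f -> (forall x, 0 <= f x) ->
  \int[nu]_x f x = \int[mu]_x (f x * (w x)%:E).
Proof.
move=> mf f0; pose h := nnsfun_approx measurableT mf.
have mwE : measurable_fun setT (EFin \o w) by exact: measurableT_comp.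
have hf x : EFin \o h^~ x @ \oo --> f x.
  by apply: cvg_nnsfun_approx => // y _; exact: f0.
have -> : \int[nu]_x f x = limn (fun n => \int[nu]_x (h n x)%:E).
  rewrite -monotone_convergence//.
  - by apply: eq_integral => x _; apply/esym/cvg_lim => //; exact: hf.
  - by move=> n; exact/measurable_EFinP/measurable_funP.
  - by move=> n x _; rewrite lee_fin.
  - by move=> x _ m n mn; rewrite lee_fin; exact/lefP/nd_nnsfun_approx.
have -> : \int[mu]_x (f x * (w x)%:E) =
    limn (fun n => \int[mu]_x ((h n x)%:E * (w x)%:E)).
  rewrite -monotone_convergence//.
  - apply: eq_integral => x _; apply/esym/cvg_lim => //.
    by apply: cvgeZr => //; exact: hf.
  - move=> n; apply: emeasurable_funM => //.
    exact/measurable_EFinP/measurable_funP.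
  - by move=> n x _; rewrite mule_ge0// lee_fin.
  - move=> x _ m n mn; apply: lee_wpmul2r; rewrite lee_fin//.
    exact/lefP/nd_nnsfun_approx.
congr (limn _); apply/funext => n.
under [LHS]eq_integral do rewrite fimfunE -fsumEFin//.
rewrite [LHS]ge0_integral_fsum//; last 2 first.
- by move=> r; exact/measurable_EFinP/measurable_funM.
- by move=> m x _; exact: nnfun_muleindic_ge0.
under [RHS]eq_integral.
  move=> x _; rewrite fimfunE -fsumEFin// ge0_mule_fsuml; last first.
    by move=> y; exact: nnfun_muleindic_ge0.
  over.
rewrite [RHS]ge0_integral_fsum//; last 2 first.
- move=> r; apply: emeasurable_funM => //.
  exact/measurable_EFinP/measurable_funM.
- by move=> r x _; rewrite mule_ge0 ?lee_fin// -lee_fin nnfun_muleindic_ge0.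
apply: eq_fsbigr => r /[!inE] -[t _ rE].
under [RHS]eq_integral do rewrite EFinM -muleA.
rewrite integralZl_indic_nnsfun// ge0_integralZl//.
- rewrite integral_indic// setIT; congr (_ * _).
  rewrite /= /density_measure integral_mkcond.
  by apply: eq_integral => x _; rewrite epatch_indic muleC.
- apply: emeasurable_funM => //; exact/measurable_EFinP.
- by move=> x _; rewrite mule_ge0// lee_fin.
- by rewrite lee_fin -rE.
Qed.

Lemma density_probability : \int[mu]_x (w x)%:E = 1 ->
  exists W : probability T R, forall f : T -> \bar R,
    measurable_fun setT f -> (forall x, 0 <= f x) ->
    \int[W]_x f x = \int[mu]_x (f x * (w x)%:E).
Proof.
move=> W1; pose W : probability T R := HB.pack nu
  (Measure_isProbability.Build _ _ _ nu W1).
by exists W; exact: ge0_integral_density.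
Qed.

End density_measure.

Section gamma_law.
Local Open Scope ereal_scope.
Context (R : realType) (nu : R).
Hypothesis nu0 : (0 < nu)%R.
Local Notation mu := (@lebesgue_measure R).

Let p_gt0 : (0 < nu^-1)%R. Proof. by rewrite invr_gt0. Qed.

Let p_neq0 : (nu^-1 != 0)%R. Proof. by rewrite gt_eqF. Qed.

Let powRK (x : R) : (0 <= x)%R -> ((x `^ nu^-1) `^ nu = x)%R.
Proof. by move=> x0; rewrite -powRrM mulVf ?gt_eqF// powRr1. Qed.

Let powRKV (x : R) : (0 <= x)%R -> ((x `^ nu) `^ nu^-1 = x)%R.
Proof. by move=> x0; rewrite -powRrM mulfV ?gt_eqF// powRr1. Qed.

Let E (c x : R) : R := expR (- (c * x `^ nu^-1)).

Let mE c D : measurable_fun D (E c).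
Proof.
apply: measurable_funTS; apply: measurableT_comp => //.
by apply: measurableT_comp => //; exact: measurable_funM.
Qed.

Let mEE c D : measurable_fun D (fun x => (E c x)%:E).
Proof. by apply/measurable_EFinP; exact: mE. Qed.

Let within_continuous_E : {within `[0%R, +oo[, continuous (E 1)}.
Proof.
apply/continuous_within_itvcyP; split => [x|].
  rewrite in_itv/= andbT => x0; rewrite /E.
  apply: continuous_comp; last exact: continuous_expR.
  apply: (@continuousN _ R^o); apply: (@continuousM _ R^o) => //.
    exact: cst_continuous.
  apply: differentiable_continuous; apply/derivable1_diffP.
  by apply: derivable_powR; rewrite in_itv/= x0.
rewrite /E.
apply: (@cvg_comp _ _ _ _ expR _ (nbhs (- (1 * 0 `^ nu^-1))%R)); last first.
  exact: continuous_expR.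
apply: cvgN; apply: cvgM; first exact: cvg_cst.
by rewrite powR0//; exact: powR_cvg0.
Qed.

Let scaling c : (0 < c)%R ->
  \int[mu]_(x in `[0%R, +oo[) (E 1 x)%:E =
  \int[mu]_(x in `[0%R, +oo[) (E c x)%:E * (c `^ nu)%:E.
Proof.
move=> c0; have b0 : (0 < c `^ nu)%R by exact: powR_gt0.
set b := (c `^ nu)%R in b0 *.
have derM : derive1 ( *%R^~ b) = cst b.
  by apply/funext => z; rewrite derive1Mr// derive1_id mul1r.
have := @increasing_ge0_integration_by_substitutiony R (fun t => t * b)%R
  (E 1) 0%R.
rewrite mul0r => ->//=.
- rewrite -[RHS]ge0_integralZr//.
  + apply: eq_integral => x; rewrite inE/= in_itv/= andbT => x0.
    rewrite -EFinM derM; congr (_ * _)%:E; rewrite /= /E; congr (expR (- _)).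
    by rewrite mul1r powRM ?(ltW b0)// powRKV ?(ltW c0)// mulrC.
  + exact: mEE.
  + by move=> x _; rewrite lee_fin expR_ge0.
  + by rewrite lee_fin ltW.
- by move=> x y _ _; rewrite ltr_pM2r.
- by rewrite derM => z _; exact: cvg_cst.
- by rewrite derM; exact: is_cvg_cst.
- by rewrite derM; exact: is_cvg_cst.
- split => //; apply: cvg_at_right_filter.
  by apply: cvgM => //; exact: cvg_cst.
- by apply: gt0_cvgMly => //; exact: cvg_id.
- by move=> x _; exact: expR_ge0.
Qed.

Let E_le_oneDsqr : exists K : R, (0 <= K)%R /\
  forall x, (0 <= x)%R -> (E 1 x <= (oneDsqr x)^-1 * K)%R.
Proof.
have [m m2nu] : exists m : nat, (nu * 2 <= m.+1%:R)%R.
  exists (Num.truncn (nu * 2)); apply: ltW; exact: truncnS_gt.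
exists (2 + m.+1`!%:R)%R; split => [|x x0]; first exact: addr_ge0.
set y := (x `^ nu^-1)%R; have y0 : (0 <= y)%R by exact: powR_ge0.
rewrite /E mul1r -/y expRN -[leLHS]mul1r ler_pdivrMr ?expR_gt0//.
rewrite -mulrA -[leLHS](@mulVf _ (oneDsqr x)) ?gt_eqF ?oneDsqr_gt0//.
rewrite ler_wpM2l ?invr_ge0 ?oneDsqr_ge0// /oneDsqr -(powRK x0) -/y.
have fac0 : (0 < m.+1`!%:R :> R)%R by rewrite ltr0n fact_gt0.
have e1 : (1 <= expR y)%R by rewrite -expR0 ler_expR.
have -> : ((y `^ nu) ^+ 2 = y `^ (nu * 2))%R.
  by rewrite powRrM -powR_mulrn ?powR_ge0.
have [y1|/ltW y1] := leP y 1%R.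
  have : (y `^ (nu * 2) <= 1 `^ (nu * 2))%R.
    by apply: ge0_ler_powR => //; rewrite ?nnegrE ?mulr_ge0// ltW.
  rewrite powR1; nra.
have : (y `^ (nu * 2) <= y ^+ m.+1)%R.
  by rewrite -powR_mulrn//; exact: ler_powR.
have := expR_ge1Dxn m y0; rewrite -lerBrDl ler_pdivrMr//; nra.
Qed.

Let Z := \int[mu]_(x in `[0%R, +oo[) (E 1 x)%:E.

Let Z_fin : Z < +oo.
Proof.
have [K [K0 HK]] := E_le_oneDsqr.
apply: (@le_lt_trans _ _
    (\int[mu]_(x in `[0%R, +oo[) ((oneDsqr x)^-1%:E * K%:E))).
  apply: ge0_le_integral => //.
  - by move=> x _; rewrite lee_fin expR_ge0.
  - exact: mEE.
  - apply/measurable_EFinP/measurable_funTS/measurable_funM => //.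
    apply: continuous_measurable_fun; exact: continuous_oneDsqrV.
  - move=> x; rewrite /= in_itv/= andbT => x0.
    by rewrite -EFinM lee_fin HK.
rewrite ge0_integralZr//.
- by rewrite integral0y_oneDsqr -EFinM ltry.
- apply/measurable_EFinP/measurable_funTS.
  by apply: continuous_measurable_fun; exact: continuous_oneDsqrV.
Qed.

Let Z_gt0 : 0 < Z.
Proof.
apply: (@lt_le_trans _ _ (\int[mu]_(x in `[0%R, 1%R]) (expR (-1))%:E)).
  rewrite integral_cst//= lebesgue_measure_itv/= lte01 sube0 mule1.
  by rewrite lte_fin expR_gt0.
apply: (@le_trans _ _ (\int[mu]_(x in `[0%R, 1%R]) (E 1 x)%:E)).
  apply: ge0_le_integral => //.
  - exact: mEE.
  - move=> x; rewrite /= in_itv/= => /andP[x0 x1].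
    rewrite lee_fin ler_expR lerN2 mul1r.
    have : (x `^ nu^-1 <= 1 `^ nu^-1)%R.
      by apply: ge0_ler_powR; rewrite ?nnegrE// ltW.
    by rewrite powR1.
apply: ge0_subset_integral => //.
- exact: mEE.
- by move=> x _; rewrite lee_fin expR_ge0.
- by apply: subset_itvl.
Qed.

Let z := fine Z.

Let ZE : Z = z%:E. Proof. by rewrite fineK// ge0_fin_numE// ltW. Qed.

Let z_gt0 : (0 < z)%R. Proof. by rewrite -lte_fin -ZE. Qed.

Let w (x : R) : R := (E 1 x / z * \1_(`]0%R, +oo[%classic) x)%R.

Let w_ge0 x : (0 <= w x)%R.
Proof. by rewrite !mulr_ge0 ?expR_ge0// invr_ge0 ltW. Qed.

Let mw : measurable_fun setT w.
Proof. by apply: measurable_funM => //; apply: measurable_funM => //; exact: mE. Qed.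

Let integral_w c : (0 <= c)%R ->
  \int[mu]_x (E c x * w x)%:E = ((1 + c) `^ (- nu))%:E.
Proof.
move=> c0; have c1 : (0 < 1 + c)%R by rewrite ltr_pwDl.
transitivity (\int[mu]_(x in `]0%R, +oo[) ((E (1 + c) x)%:E * z^-1%:E)).
  rewrite [RHS]integral_mkcond; apply: eq_integral => x _.
  rewrite patchE/= /w indicE; case: ifPn => _; last by rewrite !mulr0.
  rewrite mulr1 -EFinM mulrA /E -expRD; congr (expR _ / _)%:E; ring.
rewrite ge0_integralZr//; last 3 first.
- exact: mEE.
- by move=> x _; rewrite lee_fin expR_ge0.
- by rewrite lee_fin invr_ge0 ltW.
rewrite integral_itv_obnd_cbnd; last exact: mEE.
have := scaling c1; rewrite -/Z ZE => /eqP.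
have b0 : (0 < (1 + c) `^ nu)%R by exact: powR_gt0.
rewrite eq_sym => /eqP H.
have -> : \int[mu]_(x in `[0%R, +oo[) (E (1 + c) x)%:E = (z * ((1 + c) `^ (- nu)))%:E.
  by rewrite powRN EFinM -H -muleA -EFinM mulfV ?gt_eqF// mule1.
by rewrite -EFinM mulrC mulKf// gt_eqF.
Qed.

(* The substitution [u = x^nu] removes the singularity at [0] of the gamma
   density [x^(nu-1) e^-x]; the value [1] at [u = 0] only makes [g]
   positive everywhere. *)
Lemma gamma_law_exists : exists (W : probability (measurableTypeR R) R)
    (g : measurableTypeR R -> R),
  [/\ measurable_fun setT g, (forall u, 0 < g u)%R &
    forall s, (0 <= s)%R ->
      \int[W]_u (expR (- (s * g u)))%:E = ((1 + s) `^ (- nu))%:E].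
Proof.
have W1 : \int[mu]_x (w x)%:E = 1.
  have := integral_w (lexx 0%R).
  rewrite addr0 powR1 => <-; apply: eq_integral => x _.
  by rewrite /E mul0r oppr0 expR0 mul1r.
have [W WE] := @density_probability _ (measurableTypeR R) R mu w w_ge0 mw W1.
pose g (u : R) : R := if (u == 0)%R then 1%R else (u `^ nu^-1)%R.
have mg : measurable_fun setT g.
  apply: measurable_fun_if => //.
    exact: measurable_fun_eqr.
  by apply: measurable_funTS; exact: measurable_powR.
exists W, g; split => //.
  move=> u; rewrite /g; case: eqVneq => // u0.
  by rewrite lt0r powR_ge0 powR_eq0 (negbTE u0).
move=> s s0; rewrite WE.
- rewrite -integral_w//; apply: eq_integral => x _; rewrite -EFinM /w indicE.
  have [|] := boolP (x \in _); last by rewrite !mulr0.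
  by rewrite inE/= in_itv/= andbT => x0; rewrite /E /g gt_eqF.
- apply/measurable_EFinP; apply: measurableT_comp => //.
  by apply: measurableT_comp => //; exact: measurable_funM.
- by move=> x; rewrite lee_fin expR_ge0.
Qed.

End gamma_law.

Lemma bounded_integrable d (T : measurableType d) (R : realType)
    (P : probability T R) (f : T -> R) (M : R) :
  measurable_fun setT f -> (forall x, `|f x| <= M) ->
  P.-integrable setT (EFin \o f).
Proof.
move=> mf fM; apply: measurable_bounded_integrable => //.
  by rewrite (@le_lt_trans _ _ 1%E) ?probability_le1 ?ltry.
exists M; split; first exact: num_real.
by move=> N MN x _; exact: le_trans (fM x) (ltW MN).
Qed.

Lemma exprn_expRN_le (R : realType) (s x : R) (k : nat) : 0 < s -> 0 <= x ->
  x ^+ k * expR (- (s * x)) <= k`!%:R / s ^+ k.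
Proof.
move=> s0 x0; have sx0 : 0 <= s * x by rewrite mulr_ge0// ltW.
have fac0 : 0 < k`!%:R :> R by rewrite ltr0n fact_gt0.
rewrite expRN ler_pdivlMr ?exprn_gt0// mulrAC ler_pdivrMr ?expR_gt0//.
rewrite mulrC -exprMn.
case: k fac0 => [_|k fac0]; first by rewrite expr0 mul1r -expR0 ler_expR.
have := expR_ge1Dxn k sx0; rewrite -lerBrDl ler_pdivrMr// => /le_trans; apply.
by rewrite mulrC ler_pM2l// gerBl.
Qed.

Section laplace_moments.
Context d (U : measurableType d) (R : realType) (W : probability U R).
Variables (g : U -> R) (nu : R).
Hypotheses (mg : measurable_fun setT g) (g_ge0 : forall u, 0 <= g u).
Hypothesis laplaceE : forall s : R, 0 <= s ->
  (\int[W]_u (expR (- (s * g u)))%:E = ((1 + s) `^ (- nu))%:E)%E.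

Let f (k : nat) (s : R) (u : U) : R := g u ^+ k * expR (- (s * g u)).

Let mf k s : measurable_fun setT (f k s).
Proof.
apply: measurable_funM; first exact: measurable_funX.
apply: measurableT_comp => //; apply: measurableT_comp => //.
exact: measurable_funM.
Qed.

Let f_ge0 k s u : 0 <= f k s u.
Proof. by rewrite mulr_ge0 ?exprn_ge0 ?expR_ge0. Qed.

Let f_le k s u : 0 < s -> `|f k s u| <= k`!%:R / s ^+ k.
Proof. by move=> s0; rewrite ger0_norm//; exact: exprn_expRN_le. Qed.

Let intf k s : 0 < s -> W.-integrable setT (EFin \o f k s).
Proof.
by move=> s0; apply: bounded_integrable => // u; exact: f_le.
Qed.

Let is_derive_f k (s : R) u : is_derive s (1 : R) (f k ^~ u) (- f k.+1 s u).
Proof.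
rewrite /f; apply: is_derive_eq.
rewrite /GRing.scale/= exprSr; ring.
Qed.

Lemma Rintegral_laplace_moment k s : 0 < s ->
  \int[W]_u (g u ^+ k * expR (- (s * g u))) =
  (\prod_(j < k) (nu + j%:R)) * (1 + s) `^ (- (nu + k%:R)).
Proof.
elim: k s => [|k IH] a a0.
  rewrite big_ord0 mul1r addr0 /Rintegral.
  under eq_integral do rewrite expr0 mul1r.
  by rewrite laplaceE ?ltW.
pose F s := \int[W]_u f k s u.
have Ia : a \in `]a / 2, a + 1[.
  by rewrite in_itv/=; apply/andP; split; lra.
have I0 s : `]a / 2, a + 1[%classic s -> 0 < s.
  by rewrite /= in_itv/= => /andP[+ _]; apply: lt_trans; rewrite divr_gt0.
have d1f s u : partial1of2 (f k) s u = - f k.+1 s u.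
  by rewrite partial1of2E; apply: derive_val.
have D1 : F^`()%classic a = - \int[W]_u f k.+1 a u.
  rewrite /F (@differentiation_under_integral _ _ _ W (f k) setT
    measurableT a (a / 2) (a + 1) _ _ _ (cst (k.+1`!%:R / (a / 2) ^+ k.+1)))//.
  - under eq_Rintegral do rewrite d1f -mulN1r.
    by rewrite RintegralZl ?mulN1r//; exact: intf.
  - by move=> s /I0; exact: intf.
  - by move=> u; rewrite divr_ge0// exprn_ge0// divr_ge0// ltW.
  - apply: (@bounded_integrable _ _ _ _ _ `|k.+1`!%:R / (a / 2) ^+ k.+1|) => //.
  - move=> s u /[dup] /I0 s0; rewrite /= in_itv/= => /andP[a2s _] _.
    have a20 : 0 < a / 2 by rewrite divr_gt0.
    rewrite d1f normrN ger0_norm//.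
    apply: le_trans (exprn_expRN_le k.+1 a20 (g_ge0 u)).
    rewrite ler_wpM2l ?exprn_ge0// ler_expR lerN2 ler_wpM2r//.
    exact: ltW.
have D2 : F^`()%classic a = (\prod_(j < k) (nu + j%:R)) *
    (- (nu + k%:R) * (1 + a) `^ (- (nu + k%:R) - 1)).
  have Fnear : {near a, F =1 (fun s => (\prod_(j < k) (nu + j%:R)) *
      (1 + s) `^ (- (nu + k%:R)))}.
    by near=> s; apply: IH; near: s; exact: lt_nbhsr.
  have a1 : 0 < 1 + a by rewrite addr_gt0.
  rewrite derive1E (near_eq_derive _ Fnear) ?oner_eq0//.
  set q := - _; set c := \prod_(j < k) _.
  have D : is_derive a (1 : R) ((fun x : R => x `^ q) \o +%R 1)
      ((q * (1 + a) `^ (q - 1)) * 1).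
    apply: is_derive1_comp; first exact: is_derive1_powR.
    by apply: is_derive_eq; rewrite add0r.
  have cD : is_derive a (1 : R) (c \*: ((fun x : R => x `^ q) \o +%R 1))
    (c *: ((q * (1 + a) `^ (q - 1)) * 1)) by exact: is_deriveZ.
  rewrite -[RHS]/(c *: _) -[X in _ *: X]mulr1.
  exact: (@derive_val _ _ _ _ _ _ _ cD).
have := D1; rewrite D2 => /eqP; rewrite -eqr_oppLR => /eqP <-.
rewrite big_ord_recr/= mulNr mulrN opprK -mulrA -natr1; congr (_ * (_ * _ `^ _)).
ring.
Unshelve. all: by end_near. Qed.

End laplace_moments.

Section poisson_moments.
Local Open Scope ereal_scope.
Context (R : realType).

Lemma nneseriesSl (u : nat -> \bar R) : (forall k, 0 <= u k) ->
  \sum_(k <oo) u k = u 0%N + \sum_(k <oo) u k.+1.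
Proof.
move=> u0.
have cv : (\sum_(0 <= k < n) u k.+1 @[n --> \oo]) --> \sum_(k <oo) u k.+1.
  exact: is_cvg_nneseries.
apply/cvg_lim => //; rewrite -(cvg_shiftS (fun n => \sum_(0 <= k < n) u k))/=.
under eq_fun do rewrite big_nat_recl//.
apply: cvgeD => //; last exact: cvg_cst.
by apply: ge0_adde_def; rewrite inE//; exact: nneseries_ge0.
Qed.

Lemma sum_poisson_pmf (r : R) : (0 < r)%R ->
  \sum_(k <oo) (poisson_pmf r k)%:E = 1.
Proof.
move=> r0; have : poisson_prob r 0%N setT = 1 by exact: probability_setT.
rewrite /poisson_prob r0 -nneseries_esumT// => k.
by rewrite lee_fin poisson_pmf_ge0.
Qed.

Lemma poisson_pmfS (r : R) k : (0 < r)%R ->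
  (poisson_pmf r k.+1 * k.+1%:R = r * poisson_pmf r k)%R.
Proof.
move=> r0; rewrite /poisson_pmf r0 exprS factS natrM.
have : (k.+1%:R != 0 :> R)%R by [].
have : (k`!%:R != 0 :> R)%R by rewrite pnatr_eq0 -lt0n fact_gt0.
by move: (k.+1%:R)%R (k`!%:R)%R => a b a0 b0; field; rewrite a0.
Qed.

Lemma sum_poisson_pmf_mul (r : R) (c : nat -> R) : (0 < r)%R ->
  (forall k, 0 <= c k)%R ->
  \sum_(k <oo) (poisson_pmf r k * (k%:R * c k))%:E =
  r%:E * \sum_(k <oo) (poisson_pmf r k * c k.+1)%:E.
Proof.
move=> r0 c0; rewrite nneseriesSl; last first.
  by move=> k; rewrite lee_fin !mulr_ge0// poisson_pmf_ge0.
rewrite mul0r mulr0 add0e -nneseriesZl; last first.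
  by move=> k _; rewrite lee_fin mulr_ge0// poisson_pmf_ge0.
by apply: eq_eseriesr => k _; rewrite mulrA poisson_pmfS// -mulrA EFinM.
Qed.

Lemma poisson_variance (r : R) : (0 < r)%R ->
  \sum_(k <oo) (poisson_pmf r k * (k%:R - r) ^+ 2)%:E = r%:E.
Proof.
move=> r0; have p0 k := @poisson_pmf_ge0 R r k.
have m1 : \sum_(k <oo) (poisson_pmf r k * (k%:R * 1))%:E = r%:E.
  rewrite (@sum_poisson_pmf_mul r (fun=> 1%R))//.
  by under eq_eseriesr do rewrite mulr1; rewrite sum_poisson_pmf// mule1.
have m2 : \sum_(k <oo) (poisson_pmf r k * (k%:R * k%:R))%:E = (r ^+ 2 + r)%:E.
  rewrite (@sum_poisson_pmf_mul r (fun k => k%:R))//.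
  under eq_eseriesr do rewrite -natr1 mulrDr EFinD -[X in (poisson_pmf r _ * X)%:E]mulr1.
  rewrite nneseriesD; last 2 first.
  - by move=> k _ _; rewrite lee_fin !mulr_ge0.
  - by move=> k _ _; rewrite lee_fin !mulr_ge0.
  rewrite m1; under eq_eseriesr do rewrite mulr1.
  by rewrite sum_poisson_pmf// -EFinD -EFinM mulrDr mulr1.
set v := (X in X = _).
suff : v + (2 * r)%:E * r%:E = (r ^+ 2 + r)%:E + (r ^+ 2)%:E * 1.
  move/eqP; rewrite -EFinM mule1 -EFinD; move: v => [v| |]//.
  by rewrite -EFinD eqe => /eqP H; congr EFin; lra.
rewrite -{1}m1 -m2 -(sum_poisson_pmf r0) -!nneseriesZl; last 2 first.
- by move=> k _; rewrite lee_fin.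
- by move=> k _; rewrite lee_fin !mulr_ge0.
have v0 k : (0 <= k)%N -> true ->
    0 <= (poisson_pmf r k * (k%:R - r) ^+ 2)%:E.
  by rewrite lee_fin mulr_ge0// sqr_ge0.
rewrite /v -!nneseriesD//;
  try by move=> k _ _; rewrite lee_fin !mulr_ge0 ?(ltW r0).
apply: eq_eseriesr => k _; rewrite -!EFinM -!EFinD; congr EFin; ring.
Qed.

End poisson_moments.

Lemma negbin_pmf_mixture d (U : measurableType d) (R : realType)
    (W : probability U R) (g : U -> R) (nu : R) (n k : nat) :
  measurable_fun setT g -> (forall u, 0 < g u) ->
  (forall s : R, 0 <= s ->
    (\int[W]_u (expR (- (s * g u)))%:E = ((1 + s) `^ (- nu))%:E)%E) ->
  (2 <= n)%N ->
  (\int[W]_u (poisson_pmf (n.-1%:R * g u) k)%:E =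
   (negbin_pmf nu n%:R^-1 k.+1)%:E)%E.
Proof.
move=> mg g0 gE n2; have n1 : 0 < n.-1%:R :> R by rewrite ltr0n; case: n n2 => [|[]].
have n0 : 0 < n%:R :> R by rewrite ltr0n (leq_trans _ n2).
have n1E : n.-1%:R = n%:R - 1 :> R by rewrite -subn1 natrB// (leq_trans _ n2).
have fac0 : k`!%:R != 0 :> R by rewrite pnatr_eq0 -lt0n fact_gt0.
have pE u : poisson_pmf (n.-1%:R * g u) k =
    (n.-1%:R ^+ k / k`!%:R) * (g u ^+ k * expR (- (n.-1%:R * g u))).
  by rewrite /poisson_pmf mulr_gt0// exprMn; field.
have int : W.-integrable setT
    (EFin \o (fun u => g u ^+ k * expR (- (n.-1%:R * g u)))).
  apply: (@bounded_integrable _ _ _ _ _ (k`!%:R / n.-1%:R ^+ k)).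
    apply: measurable_funM; first exact: measurable_funX.
    apply: measurableT_comp => //; apply: measurableT_comp => //.
    exact: measurable_funM.
  move=> u; rewrite ger0_norm; last by rewrite mulr_ge0 ?expR_ge0// exprn_ge0// ltW.
  by apply: exprn_expRN_le => //; exact: ltW.
under eq_integral do rewrite pE EFinM.
rewrite integralZl// -[X in (_ * X)%E]fineK; last exact: integrable_fin_num.
rewrite -EFinM; congr EFin.
have := @Rintegral_laplace_moment _ _ _ W g nu mg (fun u => ltW (g0 u)) gE k _ n1.
rewrite /Rintegral => ->.
have -> : 1 + n.-1%:R = n%:R :> R by rewrite n1E; ring.
rewrite /negbin_pmf/= opprD powRD; last by apply/implyP => _; rewrite gt_eqF.
rewrite powR_invn ?ltW// -(@powR_inv1 _ n%:R) ?ltW// -powRrM mulN1r.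
rewrite powR_inv1 ?ltW//.
have -> : 1 - n%:R^-1 = n.-1%:R / n%:R :> R by rewrite n1E; field; rewrite gt_eqF.
rewrite expr_div_n; field.
by rewrite fac0 expf_neq0// gt_eqF.
Qed.

Section independence.
Context d (T : measurableType d) (R : realType) (P : probability T R).
Variables (X : nat -> {RV P >-> R}) (N : T -> nat).
Hypotheses (mN : measurable_fun setT N) (indep : indep_of_seq N X).

Let cylinders : set (set T) := [set C | exists m (B : nat -> set R),
  (forall i, measurable (B i)) /\ C = \bigcap_(i in `I_m) (X i @^-1` B i)].

Let setI_closed_cylinders : setI_closed cylinders.
Proof.
move=> _ _ [m1 [B1 [mB1 ->]]] [m2 [B2 [mB2 ->]]].
pose res m (B : nat -> set R) i := if (i < m)%N then B i else setT.
have resE m m' B : (m <= m')%N -> \bigcap_(i in `I_m) (X i @^-1` B i) =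
    \bigcap_(i in `I_m') (X i @^-1` res m B i).
  move=> mm'; apply/seteqP; split => w /= h i /=; rewrite /res.
    by move=> _; case: ifPn => // im; exact: h.
  by move=> im; have := h i (leq_trans im mm'); rewrite /res im.
exists (maxn m1 m2), (fun i => res m1 B1 i `&` res m2 B2 i); split.
  by move=> i; apply: measurableI; rewrite /res; case: ifPn.
rewrite (resE _ _ B1 (leq_maxl m1 m2)) (resE _ _ B2 (leq_maxr m1 m2)).
by rewrite -bigcapI; apply: eq_bigcapr => i _; rewrite preimage_setI.
Qed.

Let mX i (B : set R) : measurable B -> measurable (X i @^-1` B).
Proof. by move=> mB; rewrite -[_ @^-1` _]setTI; exact: measurable_funP. Qed.

Let mNA A : measurable (N @^-1` A).
Proof. by rewrite -[_ @^-1` _]setTI; exact: mN. Qed.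

Let indep_cylinders (A : set nat) : <<s cylinders >> `<=`
  [set E | measurable E /\ (P (N @^-1` A `&` E) = P (N @^-1` A) * P E)%E].
Proof.
apply: lambda_system_subset => //.
- apply/dynkin_lambda_system; split => /=.
  + by rewrite setIT probability_setT mule1.
  + move=> E [mE PE]; split; first exact: measurableC.
    rewrite -setDE measureD//; last by rewrite (le_lt_trans (probability_le1 _ _))// ltry.
    rewrite [X in (_ - X)%E]PE probability_setC//.
    by rewrite muleBr ?mule1//; exact: fin_num_measure.
  + move=> F tF FE; have mF n : measurable (F n) by have [] := FE n.
    split; first exact: bigcupT_measurable.
    rewrite setI_bigcupr measure_bigcup//; last 2 first.
    * by move=> n _; exact: measurableI.
    * exact: trivIset_setIl.
    rewrite measure_bigcup//.
    transitivity (\sum_(n <oo | n \in setT) ((fine (P (N @^-1` A)))%:E * P (F n)))%E.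
      apply: eq_eseriesr => n _; rewrite fineK; first exact: (FE n).2.
      exact: fin_num_measure.
    by rewrite nneseriesZl// fineK//; exact: fin_num_measure.
- move=> _ [m [B [mB ->]]]; split; last exact: indep.
  by apply: bigcap_measurableType => i _; exact: mX.
Qed.

Let measurable_sum_cylinders k :
  measurable_fun setT (fun w : g_sigma_algebraType cylinders => \sum_(i < k) X i w).
Proof.
apply: measurable_sum => i _ B mB; rewrite setTI; apply: sub_sigma_algebra.
exists (i : nat).+1, (fun j : nat => if j == i then B else setT); split => [j|].
  by case: ifPn.
apply/seteqP; split => w /=.
  by move=> Bw j /= _; case: eqVneq => // ->.
by move=> /(_ i (ltnSn _)); rewrite /= eqxx.
Qed.

Lemma indep_sum (A : set nat) k (B : set R) : measurable B ->
  (P (N @^-1` A `&` (fun w => (\sum_(i < k) X i w)%R) @^-1` B) =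
   P (N @^-1` A) * P ((fun w => (\sum_(i < k) X i w)%R) @^-1` B))%E.
Proof.
move=> mB; apply: (indep_cylinders A _).2.
by have := @measurable_sum_cylinders k measurableT B mB; rewrite setTI.
Qed.

End independence.

Lemma ge0_integral_indep_event d (T : measurableType d) (R : realType)
    (P : probability T R) (A : set T) (Y : T -> R) (f : R -> \bar R) :
  measurable A -> measurable_fun setT Y ->
  (forall B, measurable B -> P (A `&` Y @^-1` B) = P A * P (Y @^-1` B))%E ->
  measurable_fun setT f -> (forall x, 0 <= f x)%E ->
  (\int[P]_(w in A) f (Y w) = P A * \int[P]_w f (Y w))%E.
Proof.
move=> mA mY AY mf f0; pose i (w : T) : R := \1_A w.
have i0 w : 0 <= i w by rewrite /i indicE.
have mi : measurable_fun setT i by exact: measurable_indic.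
have a0 : 0 <= fine (P A) by exact: fine_ge0.
pose Y' : {RV P >-> R} := HB.pack Y (isMeasurableFun.Build _ _ _ _ _ mY).
pose nu := density_measure P i0 mi.
have mfY : measurable_fun setT (f \o Y) by exact: measurableT_comp.
transitivity (\int[nu]_w (f \o Y) w)%E.
  rewrite ge0_integral_density//; last by move=> w; exact: f0.
  by rewrite [LHS]integral_mkcond; apply: eq_integral => w _; rewrite epatch_indic.
transitivity (\int[pushforward nu Y]_x f x)%E.
  by rewrite ge0_integral_pushforward.
transitivity (\int[mscale (NngNum a0) (distribution P Y')]_x f x)%E.
  apply: eq_measure_integral => B mB _.
  rewrite /mscale/= /pushforward/= /nu /density_measure/= integral_indic//.
    transitivity ((fine (P A))%:E * P (Y @^-1` B))%E => //.
    by rewrite fineK; [exact: AY|exact: fin_num_measure].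
  by rewrite -[_ @^-1` _]setTI; exact: (mY measurableT B mB).
rewrite ge0_integral_mscale// ge0_integral_distribution//=.
by rewrite fineK//; exact: fin_num_measure.
Qed.

Lemma measurable_fun_random_index d (T : measurableType d) (R : realType)
    (N : T -> nat) (Y : nat -> T -> R) :
  measurable_fun setT N -> (forall k, measurable_fun setT (Y k)) ->
  measurable_fun setT (fun w => Y (N w) w).
Proof.
move=> mN mY _ B mB; rewrite setTI.
rewrite (_ : _ @^-1` _ = \bigcup_k (N @^-1` [set k] `&` Y k @^-1` B)).
  apply: bigcupT_measurable => k; apply: measurableI.
    by rewrite -[_ @^-1` _]setTI; exact: mN.
  by rewrite -[_ @^-1` _]setTI; exact: mY.
apply/seteqP; split => w /=; first by move=> Bw; exists (N w).
by move=> [k _ [/= <-]].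
Qed.

Lemma expectation_random_sum d (T : measurableType d) (R : realType)
    (P : probability T R) (X : nat -> {RV P >-> R}) (N : T -> nat)
    (f : R -> \bar R) (b : R) :
  measurable_fun setT N -> indep_of_seq N X ->
  measurable_fun setT f -> (forall x, 0 <= f x)%E ->
  (\int[P]_w f (b * \sum_(i < N w) X i w)%R =
   \sum_(k <oo)
     (P (N @^-1` [set k]) * \int[P]_w f (b * \sum_(i < k) X i w)%R))%E.
Proof.
move=> mN NX mf f0.
have mN1 k : measurable (N @^-1` [set k]).
  by rewrite -[_ @^-1` _]setTI; exact: mN.
have mS k : measurable_fun setT (fun w => \sum_(i < k) X i w).
  by apply: measurable_sum => i _; exact: measurable_funP.
have NT : setT = \bigcup_k (N @^-1` [set k]).
  by apply/esym/seteqP; split => // w _; exists (N w).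
rewrite [in LHS]NT ge0_integral_bigcup//; last 2 first.
- apply: measurable_funTS; apply: measurableT_comp => //.
  apply: (@measurable_fun_random_index _ _ _ N
    (fun k w => b * \sum_(i < k) X i w)) => // k.
  exact: measurable_funM.
- by apply/trivIsetP => i j _ _ ij; apply/seteqP; split => // w /= [-> /eqP];
    rewrite (negbTE ij).
apply: eq_eseriesr => k _.
rewrite -(@ge0_integral_indep_event _ _ _ P _
  (fun w => \sum_(i < k) X i w) (fun x => f (b * x)))//.
- by apply: eq_integral => w; rewrite inE/= => ->.
- by move=> B mB; apply: indep_sum.
- by apply: measurableT_comp => //; exact: measurable_funM.
Qed.

Lemma near_dilation_compact (R : realType) (f : R -> R) (a B e : R) :
  continuous f -> 0 < e ->
  \forall c \near a, forall y, `|y| <= B -> `|f (c * y) - f (a * y)| < e.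
Proof.
move=> cf e0.
have /compact_near_coveringP cov := @segment_compact R (- B) B.
have loc (y0 : R) : \forall y \near y0 & c \near nbhs a, `|f (c * y) - f (a * y)| < e.
  have cvg0 : (f (z.2 * z.1) - f (a * z.1)) @[z --> (y0, a)] --> (0:R).
    rewrite -(subrr (f (a * y0))); apply: cvgB.
      apply: (@cvg_comp _ _ _ (fun z => z.2 * z.1) f _ (nbhs (a * y0))); last exact: cf.
      by apply: cvgM; [exact: cvg_snd|exact: cvg_fst].
    apply: (@cvg_comp _ _ _ (fun z => a * z.1) f _ (nbhs (a * y0))); last exact: cf.
    by apply: cvgM; [exact: cvg_cst|exact: cvg_fst].
  exact: (@cvgr0_norm_lt _ _ _ _ _ _ cvg0 _ e0).
have := cov R (nbhs a) (fun c y => `|f (c * y) - f (a * y)| < e)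
  (nbhs_filter a) (fun y _ => loc y).
apply: (@filterS _ (nbhs a)) => c H y yB.
by apply: H; rewrite /= in_itv/= -ler_norml.
Qed.

Lemma integral_cst_probability d (T : measurableType d) (R : realType)
    (P : probability T R) (c : \bar R) : (\int[P]_x c = c)%E.
Proof.
rewrite integral_cst// -[RHS]mule1; congr (_ * _)%E.
exact: (@probability_setT _ _ _ P).
Qed.

Lemma Rintegral_cst_probability d (T : measurableType d) (R : realType)
    (P : probability T R) (r : R) : \int[P]_x r = r.
Proof.
rewrite Rintegral_cst// -[RHS]mulr1; congr (_ * _).
exact: (congr1 fine (@probability_setT _ _ _ P)).
Qed.

Lemma continuous_bounded_integrable d (T : measurableType d) (R : realType)
    (P : probability T R) (f : R -> R) (Y : T -> R) (M : R) :
  continuous f -> (forall x, `|f x| <= M) -> measurable_fun setT Y ->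
  P.-integrable setT (EFin \o (f \o Y)).
Proof.
move=> cf fM mY; apply: (@bounded_integrable _ _ _ _ _ M).
  by apply: measurableT_comp => //; exact: continuous_measurable_fun.
by move=> w; exact: fM.
Qed.

Lemma conv_in_distr_Rintegral d (T : measurableType d) (R : realType)
    (P : probability T R) (Y : nat -> T -> R) (S : probability R R)
    (f : R -> R) (M : R) :
  conv_in_distr P Y S -> continuous f -> (forall x, `|f x| <= M) ->
  (\int[P]_w f (Y n w)) @[n --> \oo] --> \int[S]_x f x.
Proof.
move=> YS cf fM; apply: fine_cvg; rewrite fineK; first by apply: YS => //; exists M.
apply: integrable_fin_num => //.
by have := @continuous_bounded_integrable _ _ _ S f id M cf fM (@measurable_id _ _ _).
Qed.

Section tightness.
Context (R : realType).

Definition tail_cutoff (m : nat) (x : R) : R := Num.min 1 (`|x| / m.+1%:R).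

Lemma continuous_tail_cutoff m : continuous (tail_cutoff m).
Proof.
move=> x; apply: (@continuous_min _ R (cst 1) (fun y => `|y| / m.+1%:R)).
  exact: cst_continuous.
by apply: cvgMr_tmp; apply: norm_continuous.
Qed.

Lemma tail_cutoff_ge0 m x : 0 <= tail_cutoff m x.
Proof. by rewrite le_min ler01 divr_ge0. Qed.

Lemma normr_tail_cutoff m x : `|tail_cutoff m x| <= 1.
Proof. by rewrite ger0_norm ?tail_cutoff_ge0// ge_min lexx. Qed.

Lemma tail_cutoff1 m x : m.+1%:R <= `|x| -> tail_cutoff m x = 1.
Proof. by move=> mx; apply: min_l; rewrite ler_pdivlMr// mul1r. Qed.

Lemma cvg_tail_cutoff x : tail_cutoff m x @[m --> \oo] --> (0 : R).
Proof.
apply: (@squeeze_cvgr _ _ _ _ (fun=> 0) (fun m => `|x| / m.+1%:R)).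
- by near=> m; rewrite tail_cutoff_ge0 ge_min lexx orbT.
- exact: cvg_cst.
- by rewrite -(mulr0 `|x|); apply: cvgM; [exact: cvg_cst|exact: cvg_harmonic].
Unshelve. all: by end_near. Qed.

Lemma cvg_Rintegral_tail_cutoff (S : probability R R) :
  (\int[S]_x tail_cutoff m x) @[m --> \oo] --> (0 : R).
Proof.
apply: fine_cvg.
have [|||||_ _] := @dominated_convergence _ _ _ S setT measurableT
  (fun m x => (tail_cutoff m x)%:E) (cst 0)%E (cst 1)%E.
- move=> m; apply/measurable_EFinP; apply: continuous_measurable_fun.
  exact: continuous_tail_cutoff.
- by [].
- apply: aeW => x _; apply: cvg_EFin; first by near=> m.
  exact: cvg_tail_cutoff.
- by apply: (@bounded_integrable _ _ _ S (cst 1) 1) => // x; rewrite normr1.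
- by apply: aeW => x m _; rewrite abse_EFin lee_fin normr_tail_cutoff.
- by rewrite integral0.
Unshelve. all: by end_near. Qed.

End tightness.

(* [f (c y)] and [f (a y)] are uniformly close on compacts, and the mass of
   [Y k] escaping a large compact is controlled by that of its limit. *)
Lemma conv_in_distr_dilation d (T : measurableType d) (R : realType)
    (P : probability T R) (Y : nat -> T -> R) (S : probability R R)
    (f : R -> R) (M a e : R) :
  (forall k, measurable_fun setT (Y k)) -> conv_in_distr P Y S ->
  continuous f -> (forall x, `|f x| <= M) -> 0 < e ->
  exists K, \forall c \near a, forall k, (K <= k)%N ->
    `|\int[P]_w f (c * Y k w) - \int[S]_x f (a * x)| <= e.
Proof.
move=> mY YS cf fM e0.
have M0 : 0 <= M by rewrite (le_trans _ (fM 0)).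
pose e1 := e / 4 / (2 * M + 1).
have e10 : 0 < e1 by rewrite !divr_gt0// ltr_wpDl// mulr_ge0.
have cd (b : R) : continuous (fun x => f (b * x)).
  move=> x; apply: (@continuous_comp _ _ _ ( *%R b) f); last exact: cf.
  exact: mulrl_continuous.
have ifY b k : P.-integrable setT (EFin \o (fun w => f (b * Y k w))).
  exact: (@continuous_bounded_integrable _ _ _ P (fun x => f (b * x)) (Y k) M).
have [m Sm] : exists m, \int[S]_x tail_cutoff m x < e1.
  have := @cvgr0_norm_lt _ _ _ _ _ _ (cvg_Rintegral_tail_cutoff S) _ e10.
  by move=> [m _ /(_ m (leqnn _))]/ltr_normlW; exists m.
have ch := @continuous_tail_cutoff R m.
have ihY k : P.-integrable setT (EFin \o (fun w => tail_cutoff m (Y k w))).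
  exact: (@continuous_bounded_integrable _ _ _ P (tail_cutoff m) (Y k) 1 ch
    (normr_tail_cutoff m)).
have nearh : \forall k \near \oo, \int[P]_w tail_cutoff m (Y k w) < e1 + e1.
  have := conv_in_distr_Rintegral YS ch (normr_tail_cutoff m).
  by move=> /cvgr_lt; apply; rewrite (lt_trans Sm)// ltrDl.
have nearf : \forall k \near \oo,
    `|\int[P]_w f (a * Y k w) - \int[S]_x f (a * x)| <= e / 4.
  have := conv_in_distr_Rintegral YS (cd a) (fun x => fM (a * x)).
  by move=> /cvgrPdist_le /(_ (e / 4)) H; under eq_near do rewrite distrC;
    apply: H; rewrite divr_gt0.
have e40 : 0 < e / 4 by rewrite divr_gt0.
have neara := @near_dilation_compact R f a m.+1%:R (e / 4) cf e40.
have [K1 _ nearhK] := nearh.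
have [K2 _ nearfK] := nearf.
exists (maxn K1 K2); apply: (@filterS _ (nbhs a)) neara => c ha k.
rewrite geq_max => /andP[/nearhK hk /nearfK fk].
have pw y : `|f (c * y) - f (a * y)| <= e / 4 + 2 * M * tail_cutoff m y.
  have [ym|/ltW ym] := leP `|y| m.+1%:R.
    rewrite (le_trans (ltW (ha _ ym)))// lerDl !mulr_ge0//.
    exact: tail_cutoff_ge0.
  rewrite tail_cutoff1// mulr1 (le_trans (ler_normB _ _))//.
  have := fM (c * y); have := fM (a * y); lra.
have : `|\int[P]_w f (c * Y k w) - \int[P]_w f (a * Y k w)| <=
    e / 4 + 2 * M * \int[P]_w tail_cutoff m (Y k w).
  rewrite -RintegralB//.
  apply: le_trans (le_normr_Rintegral _ _) _ => //.
    by have := integrableB measurableT (ifY c k) (ifY a k).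
  have -> : e / 4 + 2 * M * \int[P]_w tail_cutoff m (Y k w) =
      \int[P]_w (e / 4 + 2 * M * tail_cutoff m (Y k w)).
    rewrite RintegralD//; last 2 first.
    - exact: (@bounded_integrable _ _ _ P (cst (e / 4)) `|e / 4|).
    - have := @integrableZl _ _ _ P setT measurableT (2 * M) _ (ihY k).
      by apply: eq_integrable => // w _.
    by rewrite Rintegral_cst_probability RintegralZl.
  apply: le_Rintegral => //.
  - have := integrable_abse (integrableB measurableT (ifY c k) (ifY a k)).
    by apply: eq_integrable => // w _.
  - apply: (@bounded_integrable _ _ _ P _ (e / 4 + 2 * M)).
      apply: measurable_funD => //; apply: measurable_funM => //.
      apply: measurableT_comp => //; exact: continuous_measurable_fun.
    move=> w; rewrite ger0_norm; last first.
      by rewrite addr_ge0 ?divr_ge0 ?(ltW e0)// !mulr_ge0// tail_cutoff_ge0.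
    rewrite lerD2l ler_piMr ?mulr_ge0//.
    by have := normr_tail_cutoff m (Y k w); rewrite ger0_norm ?tail_cutoff_ge0.
have : 2 * M * \int[P]_w tail_cutoff m (Y k w) <= e / 2.
  have D0 : 0 < 2 * M + 1 by rewrite ltr_wpDl// mulr_ge0.
  have De1 : (2 * M + 1) * e1 = e / 4 by rewrite /e1; field; rewrite gt_eqF.
  nra.
move=> h1 h2; have := ler_distD (\int[P]_w f (a * Y k w))
  (\int[P]_w f (c * Y k w)) (\int[S]_x f (a * x)).
lra.
Qed.

Section poisson_average.
Context (R : realType).

Lemma sum_poisson_affine (r e C s : R) : 0 < r -> 0 <= e -> 0 <= C -> 0 <= s ->
  (\sum_(k <oo) (poisson_pmf r k * (e + C * ((k%:R - r) ^+ 2 + s)))%:E =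
   (e + C * (r + s))%:E)%E.
Proof.
move=> r0 e0 C0 s0; have p0 k := @poisson_pmf_ge0 R r k.
transitivity (\sum_(k <oo) ((e + C * s)%:E * (poisson_pmf r k)%:E +
    C%:E * (poisson_pmf r k * (k%:R - r) ^+ 2)%:E))%E.
  by apply: eq_eseriesr => k _; rewrite -!EFinM -EFinD; congr EFin; ring.
rewrite nneseriesD; last 2 first.
- by move=> k _ _; rewrite -EFinM lee_fin mulr_ge0// addr_ge0// mulr_ge0.
- by move=> k _ _; rewrite -EFinM lee_fin mulr_ge0// mulr_ge0// sqr_ge0.
rewrite !nneseriesZl; last 2 first.
- by move=> k _; rewrite lee_fin mulr_ge0// ?sqr_ge0.
- by move=> k _; rewrite lee_fin.
rewrite sum_poisson_pmf// poisson_variance// mule1 -EFinM -EFinD; congr EFin; ring.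
Qed.

Lemma poisson_average_dist (r l e C s : R) (a : nat -> R) :
  0 < r -> 0 <= l -> 0 <= e -> 0 <= C -> 0 <= s -> (forall k, 0 <= a k) ->
  (forall k, `|a k - l| <= e + C * ((k%:R - r) ^+ 2 + s)) ->
  `|fine (\sum_(k <oo) (poisson_pmf r k * a k)%:E)%E - l| <= e + C * (r + s).
Proof.
move=> r0 l0 e0 C0 s0 a0 al; have p0 k := @poisson_pmf_ge0 R r k.
set A := (\sum_(k <oo) _)%E.
have A0 : (0 <= A)%E by apply: nneseries_ge0 => k _ _; rewrite lee_fin mulr_ge0.
have Ale : (A <= (l + e + C * (r + s))%:E)%E.
  rewrite -sum_poisson_affine ?addr_ge0//; apply: lee_nneseries => k.
    by rewrite lee_fin mulr_ge0.
  by move=> _; rewrite lee_fin ler_wpM2l//; have := al k; rewrite ler_norml; lra.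
have leA : (l%:E <= A + (e + C * (r + s))%:E)%E.
  rewrite -sum_poisson_affine// -[leLHS]mule1 -(sum_poisson_pmf r0) -nneseriesZl; last first.
    by move=> k _; rewrite lee_fin.
  rewrite -nneseriesD.
  - apply: lee_nneseries => k; first by rewrite -EFinM lee_fin mulr_ge0.
    move=> _; rewrite -EFinM -EFinD lee_fin mulrC -mulrDr ler_wpM2l//.
    by have := al k; rewrite ler_norml; lra.
  - by move=> k _ _; rewrite lee_fin mulr_ge0.
  - move=> k _ _; rewrite lee_fin mulr_ge0// addr_ge0// mulr_ge0// addr_ge0//.
    exact: sqr_ge0.
move: A0 Ale leA; case: A => [A| |]//=; rewrite !lee_fin => A0 Ale leA.
by rewrite ler_norml; apply/andP; split; lra.
Qed.

End poisson_average.

Lemma powRV_div (R : realType) (q x y : R) : 0 < x -> 0 < y ->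
  (y `^ q)^-1 * x `^ q = (x / y) `^ q.
Proof.
move=> x0 y0; rewrite powRM ?invr_ge0 ?ltW// -(powR_inv1 (ltW y0)).
by rewrite -powRrM mulN1r powRN mulrC.
Qed.

Section poisson_limit.
Context d (T : measurableType d) (R : realType) (P : probability T R).
Variables (alpha : R) (Z : nat -> T -> R) (S : probability R R).
Hypothesis mZ : forall k, measurable_fun setT (Z k).
Hypothesis ZS : conv_in_distr P (fun n w => (n%:R `^ alpha^-1)^-1 * Z n w) S.
Variables (f : R -> R) (M : R).
Hypotheses (cf : continuous f) (f_ge0 : forall x, 0 <= f x)
  (fM : forall x, f x <= M).

Let a n k := \int[P]_w f ((n%:R `^ alpha^-1)^-1 * Z k w).

Lemma Rintegral_mean_bounds d' (T' : measurableType d') (Q : probability T' R)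
    (h : T' -> R) : measurable_fun setT h -> 0 <= \int[Q]_w f (h w) <= M.
Proof.
move=> mh; apply/andP; split; first by apply: Rintegral_ge0 => w _; exact: f_ge0.
rewrite -[leRHS](Rintegral_cst_probability Q); apply: le_Rintegral => //.
- apply: (@continuous_bounded_integrable _ _ _ Q f h M) => // x.
  by rewrite ger0_norm.
- exact: (@bounded_integrable _ _ _ Q (cst M) `|M|).
Qed.

(* The Poisson law of parameter [(n-1)x] concentrates around [nx], where
   [k^(1/alpha) / n^(1/alpha)] is close to [x^(1/alpha)]. *)
Lemma cvg_poisson_average (x : R) : 0 < x ->
  fine (\sum_(k <oo) (poisson_pmf (n.-1%:R * x) k * a n k.+1)%:E)%E
    @[n --> \oo] --> \int[S]_s f (x `^ alpha^-1 * s).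
Proof.
move=> x0; set psi := \int[S]_s _.
have normf y : `|f y| <= M by rewrite ger0_norm.
have M0 : 0 <= M by rewrite (le_trans (f_ge0 0)).
apply/cvgrPdist_le => e e0; have e20 : 0 < e / 2 by rewrite divr_gt0.
have [|K nearK] := @conv_in_distr_dilation _ _ _ P _ S f M (x `^ alpha^-1) (e / 2) _
  ZS cf normf e20.
  by move=> k; exact: measurable_funM.
have powc : {for x, continuous (fun y : R => y `^ alpha^-1)}.
  apply: differentiable_continuous; apply/derivable1_diffP.
  by apply: derivable_powR; rewrite in_itv/= x0.
have := powc _ nearK; move=> /nbhs_ballP[eta0 /= eta00 Heta].
pose eta := Num.min eta0 (x / 2).
have eta_gt0 : 0 < eta by rewrite lt_min eta00 divr_gt0.
have psi_bd : 0 <= psi <= M.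
  by apply: Rintegral_mean_bounds; exact: mulrl_measurable.
pose C n : R := 2 * M / eta ^+ 2 / n%:R ^+ 2.
pose s := (1 - x) ^+ 2.
have bound n k : (0 < n)%N -> K%:R <= n%:R * (x / 2) ->
    `|a n k.+1 - psi| <= e / 2 + 2 * C n * ((k%:R - n.-1%:R * x) ^+ 2 + s).
  move=> n0 nK; have nR0 : 0 < n%:R :> R by rewrite ltr0n.
  have C0 : 0 <= C n by rewrite !divr_ge0 ?exprn_ge0 ?mulr_ge0// ltW.
  have q0 : 0 <= (k%:R - n.-1%:R * x) ^+ 2 + s by rewrite addr_ge0// sqr_ge0.
  have [near_x|far_x] := ltP `|k.+1%:R / n%:R - x| eta.
    have aE : a n k.+1 = \int[P]_w f ((k.+1%:R / n%:R) `^ alpha^-1 *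
        ((k.+1%:R `^ alpha^-1)^-1 * Z k.+1 w)).
      rewrite /a; apply: eq_Rintegral => w _; congr f.
      rewrite -powRV_div// mulrA; congr (_ * _).
      by rewrite mulfK// gt_eqF// powR_gt0.
    rewrite aE (@le_trans _ _ (e / 2))//; last first.
      by rewrite lerDl mulr_ge0// mulr_ge0.
    apply: Heta; first by rewrite /ball/= distrC (lt_le_trans near_x)// ge_min lexx.
    rewrite -(@ler_nat R) (le_trans nK)// mulrC -ler_pdivlMr//.
    have : `|k.+1%:R / n%:R - x| < x / 2.
      by rewrite (lt_le_trans near_x)// ge_min lexx orbT.
    by rewrite ltr_norml; lra.
  apply: (@le_trans _ _ (2 * M)).
    have : 0 <= a n k.+1 <= M.
      by apply: Rintegral_mean_bounds; exact: measurable_funM.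
    by rewrite ler_norml; move: psi_bd; lra.
  have sq : eta ^+ 2 * n%:R ^+ 2 <= 2 * ((k%:R - n.-1%:R * x) ^+ 2 + s).
    have : eta ^+ 2 <= (k.+1%:R / n%:R - x) ^+ 2.
      by rewrite -[leRHS]real_normK ?num_real// ler_sqr ?nnegrE// ltW.
    rewrite -(@ler_pM2r _ (n%:R ^+ 2)) ?exprn_gt0// => /le_trans; apply.
    have -> : (k.+1%:R / n%:R - x) ^+ 2 * n%:R ^+ 2 =
        ((k%:R - n.-1%:R * x) + (1 - x)) ^+ 2.
      have -> : n.-1%:R = n%:R - 1 :> R by rewrite -subn1 natrB.
      by rewrite -natr1; field; rewrite gt_eqF.
    rewrite /s; move: (k%:R - _) (1 - x) => u v.
    by have := sqr_ge0 (u - v); nra.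
  rewrite -[leLHS]add0r lerD ?(ltW e20)//.
  have -> : 2 * M = C n * (eta ^+ 2 * n%:R ^+ 2).
    by rewrite /C; field; rewrite !gt_eqF.
  by rewrite [leRHS](_ : _ = C n * (2 * ((k%:R - n.-1%:R * x) ^+ 2 + s))) ?ler_wpM2l//; ring.
near=> n; rewrite distrC.
have n1 : (1 < n)%N by near: n; exact: nbhs_infty_gt.
have n0 : (0 < n)%N by exact: ltnW.
have nK : K%:R <= n%:R * (x / 2).
  by rewrite -ler_pdivrMr ?divr_gt0//; near: n; exact: nbhs_infty_ger.
have r0 : 0 < n.-1%:R * x by rewrite mulr_gt0// ltr0n; case: (n) n1 => [|[]].
have C0 : 0 <= 2 * C n by rewrite mulr_ge0// !divr_ge0 ?exprn_ge0 ?mulr_ge0// ltW.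
have a0 k : 0 <= a n k.+1 by apply: Rintegral_ge0 => w _; exact: f_ge0.
apply: le_trans (poisson_average_dist r0 _ (ltW e20) C0 (sqr_ge0 _) a0
  (fun k => bound n k n0 nK)) _; first by case/andP: psi_bd.
rewrite [leRHS](_ : e = e / 2 + e / 2); last by field.
rewrite lerD2l; have nR0 : 0 < n%:R :> R by rewrite ltr0n.
have nbig : 2 * (2 * M / eta ^+ 2) * (x + s) / (e / 2) <= n%:R.
  by near: n; exact: nbhs_infty_ger.
have D0 : 0 <= 2 * M / eta ^+ 2 by rewrite divr_ge0 ?exprn_ge0 ?mulr_ge0// ltW.
apply: (@le_trans _ _ (2 * C n * (n%:R * (x + s)))).
  rewrite ler_wpM2l// mulrDr lerD//.
    by rewrite ler_pM2r// ler_nat leq_pred.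
  by rewrite ler_peMl ?sqr_ge0// ler1n.
have -> : 2 * C n * (n%:R * (x + s)) =
    2 * (2 * M / eta ^+ 2) * (x + s) / n%:R.
  by rewrite /C; field; rewrite !gt_eqF.
by rewrite ler_pdivrMr// [leRHS]mulrC -ler_pdivrMr.
Unshelve. all: by end_near. Qed.

End poisson_limit.
Lemma scale_mixture d (U : measurableType d) (R : realType)
    (W : probability U R) (S : probability R R) (h : U -> R) :
  measurable_fun setT h ->
  exists L : probability R R, forall (f : R -> R) (M : R),
    measurable_fun setT f -> (forall x, `|f x| <= M) ->
    (\int[L]_x (f x)%:E = \int[W]_u \int[S]_s (f (h u * s)%R)%:E)%E.
Proof.
move=> mh; pose phi (z : U * R) : R := h z.1 * z.2.
have mphi : measurable_fun setT phi.
  by apply: measurable_funM => //; apply: measurableT_comp.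
pose Q : probability _ R := (W \x S)%E.
pose phiV : {RV Q >-> R} := HB.pack phi (isMeasurableFun.Build _ _ _ _ _ mphi).
exists (distribution Q phiV) => f M mf fM.
have ifphi : Q.-integrable setT (EFin \o (f \o phi)).
  apply: (@bounded_integrable _ _ _ Q (f \o phi) M) => [|z]; last exact: fM.
  exact: (measurableT_comp mf mphi).
rewrite integral_distribution//; last exact/measurable_EFinP.
by rewrite -(integral12_prod_meas1 ifphi).
Qed.

Section random_sum_limit.
Context d (T : measurableType d) (R : realType) (P : probability T R).
Context d' (U : measurableType d') (W : probability U R).
Variables (alpha nu : R) (X : nat -> {RV P >-> R}) (N : nat -> T -> nat).
Variables (S : probability R R) (g : U -> R).
Hypothesis mg : measurable_fun setT g.
Hypothesis g_gt0 : forall u, 0 < g u.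
Hypothesis laplaceE : forall s : R, 0 <= s ->
  (\int[W]_u (expR (- (s * g u)))%:E = ((1 + s) `^ (- nu))%:E)%E.
Hypothesis XS : conv_in_distr P
  (fun n w => (n%:R `^ alpha^-1)^-1 * \sum_(i < n) X i w) S.
Hypothesis mN : forall n, measurable_fun setT (N n).
Hypothesis NX : forall n, indep_of_seq (N n) X.
Hypothesis Nnegbin : forall n, (2 <= n)%N -> is_negbin P (N n) nu n%:R^-1.

Let Z k w := \sum_(i < k) X i w.

Let mZ k : measurable_fun setT (Z k).
Proof. by apply: measurable_sum => i _; exact: measurable_funP. Qed.

Let b n : R := (n%:R `^ alpha^-1)^-1.

Let mpois n k : measurable_fun setT (fun u => poisson_pmf (n.-1%:R * g u) k).
Proof.
apply: (@measurableT_comp _ _ _ _ _ _ (poisson_pmf ^~ k)).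
  exact: measurable_poisson_pmf.
exact: measurable_funM.
Qed.

Let poisson_mixture n (c : nat -> R) : (2 <= n)%N -> (forall k, 0 <= c k) ->
  (\sum_(k <oo) (P (N n @^-1` [set k.+1]) * (c k)%:E) =
   \int[W]_u \sum_(k <oo) (poisson_pmf (n.-1%:R * g u) k * c k)%:E)%E.
Proof.
move=> n2 c0; rewrite integral_nneseries//; last 2 first.
- by move=> k; apply/measurable_EFinP/measurable_funM.
- by move=> k u _; rewrite lee_fin mulr_ge0 ?poisson_pmf_ge0.
apply: eq_eseriesr => k _; rewrite (Nnegbin n2)//.
rewrite -(negbin_pmf_mixture k mg g_gt0 laplaceE n2).
under [RHS]eq_integral do rewrite EFinM.
rewrite ge0_integralZr//.
- exact/measurable_EFinP.
- by move=> u _; rewrite lee_fin poisson_pmf_ge0.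
- by rewrite lee_fin.
Qed.

Let negbin_gt0 n : (2 <= n)%N -> P (N n @^-1` [set 0%N]) = 0%E.
Proof.
move=> n2.
have : (\int[P]_w 1 = \sum_(k <oo) (P (N n @^-1` [set k]) * 1))%E.
  rewrite (@expectation_random_sum _ _ _ P X (N n) (cst 1%E) 0)//.
  by apply: eq_eseriesr => k _; rewrite integral_cst_probability.
rewrite integral_cst_probability nneseriesSl; last first.
  by move=> k; rewrite mule1.
rewrite (poisson_mixture n2 (fun=> ler01)).
under eq_integral => u _.
  under eq_eseriesr do rewrite mulr1.
  rewrite sum_poisson_pmf; last first.
    by rewrite mulr_gt0// ltr0n; case: (n) n2 => [|[]].
  over.
rewrite integral_cst_probability mule1 => /eqP.
have : P (N n @^-1` [set 0%N]) \is a fin_num.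
  by apply: fin_num_measure; rewrite -[_ @^-1` _]setTI; exact: mN.
move=> /EFin_fin_numP[r ->]; rewrite -EFinD eqe => /eqP r1.
by congr EFin; lra.
Qed.

Let cvg_random_sum_ge0 (f : R -> R) (M : R) : continuous f ->
  (forall x, 0 <= f x) -> (forall x, f x <= M) ->
  (\int[P]_w (f (b n * \sum_(i < N n w) X i w)%R)%:E @[n --> \oo] -->
   \int[W]_u \int[S]_s (f (g u `^ alpha^-1 * s)%R)%:E)%E.
Proof.
move=> cf f0 fM.
have normf x : `|f x| <= M by rewrite ger0_norm.
have M0 : 0 <= M by rewrite (le_trans (f0 0)).
have mf : measurable_fun setT f by exact: continuous_measurable_fun.
pose a n k := \int[P]_w f (b n * Z k w).
have aE n k : (\int[P]_w (f (b n * Z k w))%:E = (a n k)%:E)%E.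
  rewrite /a /Rintegral fineK//; apply: integrable_fin_num => //.
  apply: (@continuous_bounded_integrable _ _ _ P f (fun w => b n * Z k w) M) => //.
  exact: measurable_funM.
have a0 n k : 0 <= a n k by apply: Rintegral_ge0 => w _; exact: f0.
have aM n k : a n k <= M.
  have mbZ : measurable_fun setT (fun w => b n * Z k w) by exact: measurable_funM.
  by have /andP[] := Rintegral_mean_bounds cf f0 fM P mbZ.
pose H n u := (\sum_(k <oo) (poisson_pmf (n.-1%:R * g u) k * a n k.+1)%:E)%E.
have H0 n u : (0 <= H n u)%E.
  by apply: nneseries_ge0 => k _ _; rewrite lee_fin mulr_ge0 ?poisson_pmf_ge0.
have HM n u : (2 <= n)%N -> (H n u <= M%:E)%E.
  move=> n2; have r0 : 0 < n.-1%:R * g u.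
    by rewrite mulr_gt0// ltr0n; case: (n) n2 => [|[]].
  rewrite -[leRHS]mule1 -(sum_poisson_pmf r0) -nneseriesZl; last first.
    by move=> k _; rewrite lee_fin poisson_pmf_ge0.
  apply: lee_nneseries => k; first by rewrite lee_fin mulr_ge0 ?poisson_pmf_ge0.
  by move=> _; rewrite -EFinM lee_fin mulrC ler_wpM2r// poisson_pmf_ge0.
have EH n : (2 <= n)%N ->
    (\int[P]_w (f (b n * \sum_(i < N n w) X i w)%R)%:E = \int[W]_u H n u)%E.
  move=> n2; rewrite (@expectation_random_sum _ _ _ P X (N n) (EFin \o f) (b n))//.
  - rewrite nneseriesSl; last first.
      by move=> k; rewrite mule_ge0// integral_ge0// => w _; rewrite lee_fin.
    rewrite negbin_gt0// mul0e add0e -poisson_mixture//.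
    by apply: eq_eseriesr => k _; rewrite aE.
  - exact/measurable_EFinP.
pose psi u := \int[S]_s f (g u `^ alpha^-1 * s).
have ->  : (\int[W]_u \int[S]_s (f (g u `^ alpha^-1 * s)%R)%:E =
    \int[W]_u (psi u)%:E)%E.
  apply: eq_integral => u _; rewrite /psi /Rintegral fineK//.
  apply: integrable_fin_num => //.
  apply: (@continuous_bounded_integrable _ _ _ S f ( *%R (g u `^ alpha^-1)) M) => //.
have mH n : measurable_fun setT (H n).
  apply: (@ge0_emeasurable_sum _ _ _ setT
    (fun k u => (poisson_pmf (n.-1%:R * g u) k * a n k.+1)%:E) xpredT).
    by move=> k u _ _; rewrite lee_fin mulr_ge0 ?poisson_pmf_ge0.
  by move=> k _; apply/measurable_EFinP; exact: measurable_funM.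
have cvH u : H n.+2 u @[n --> \oo] --> (psi u)%:E.
  have := @cvg_poisson_average _ _ _ P alpha Z S mZ XS f M cf f0 fM _ (g_gt0 u).
  move=> /(cvg_comp _ _ (cvg_addnr 2)) cv.
  apply/fine_cvgP; split; last first.
    by apply: cvg_trans cv; apply: near_eq_cvg; near=> n; rewrite /= addn2.
  near=> n; rewrite ge0_fin_numE//; exact: le_lt_trans (HM _ _ _) (ltry _).
have mpsi : measurable_fun setT (EFin \o psi).
  exact: (@emeasurable_fun_cvg _ _ _ _ (fun n => H n.+2) (EFin \o psi)
    (fun n => mH n.+2) (fun u _ => cvH u)).
have [|||||_ _] := @dominated_convergence _ _ _ W setT measurableT
  (fun n => H n.+2) (EFin \o psi) (cst M%:E).
- by move=> n; exact: mH.
- exact: mpsi.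
- by apply: aeW => u _; exact: cvH.
- by apply: (@bounded_integrable _ _ _ W (cst M) M) => // u; rewrite ger0_norm.
- by apply: aeW => u n _; rewrite gee0_abs// HM.
move=> cv; rewrite -(cvg_shiftn 2)/=.
apply: cvg_trans cv; apply: near_eq_cvg; near=> n.
by rewrite /= addn2 EH.
Unshelve. all: by end_near. Qed.

Lemma cvg_random_sum (f : R -> R) (M : R) : continuous f ->
  (forall x, `|f x| <= M) ->
  (\int[P]_w (f (b n * \sum_(i < N n w) X i w)%R)%:E @[n --> \oo] -->
   \int[W]_u \int[S]_s (f (g u `^ alpha^-1 * s)%R)%:E)%E.
Proof.
move=> cf fM; pose h x := f x + M.
have h0 x : 0 <= h x by have := fM x; rewrite /h ler_norml; lra.
have hM x : h x <= 2 * M by have := fM x; rewrite /h ler_norml; lra.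
have ch : continuous h by move=> x; apply: cvgD; [exact: cf|exact: cvg_cst].
have mf : measurable_fun setT f by exact: continuous_measurable_fun.
have iM d1 (T1 : measurableType d1) (Q : probability T1 R) :
    Q.-integrable setT (EFin \o cst M).
  exact: (@bounded_integrable _ _ _ Q (cst M) `|M|).
have split_M d1 (T1 : measurableType d1) (Q : probability T1 R) (Y : T1 -> R) :
    measurable_fun setT Y ->
    (\int[Q]_w (f (Y w))%:E = \int[Q]_w (h (Y w))%:E - M%:E)%E.
  move=> mY; have iY := @continuous_bounded_integrable _ _ _ Q f Y M cf fM mY.
  under [in RHS]eq_integral do rewrite EFinD.
  rewrite integralD//; last exact: iM.
  rewrite integral_cst_probability addeK//.
have mS n : measurable_fun setT (fun w => b n * \sum_(i < N n w) X i w).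
  apply: measurable_funM => //.
  exact: (@measurable_fun_random_index _ _ _ (N n) Z).
under eq_fun do rewrite split_M//.
have -> : (\int[W]_u \int[S]_s (f (g u `^ alpha^-1 * s)%R)%:E =
    \int[W]_u \int[S]_s (h (g u `^ alpha^-1 * s)%R)%:E - M%:E)%E.
  have mga : measurable_fun setT (fun u => g u `^ alpha^-1).
    apply: (@measurableT_comp _ _ _ _ _ _ (@powR R ^~ alpha^-1)) => //.
  have [L LE] := scale_mixture W S mga.
  rewrite -(LE f M)// -(LE h (2 * M)).
  - exact: (split_M _ _ L id).
  - exact: continuous_measurable_fun.
  - by move=> x; rewrite ger0_norm.
apply: cvgeB => //; last exact: cvg_cst.
- by rewrite fin_num_adde_defl.
- exact: cvg_random_sum_ge0 ch h0 hM.
Qed.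

End random_sum_limit.

Theorem theorem6 (d : measure_display) (T : measurableType d) (R : realType)
  (P : probability T R) (alpha nu : R)
  (X : nat -> {RV P >-> R}) (N : nat -> T -> nat) :
  0 < alpha -> alpha <= 2 -> 0 < nu ->
  mutually_independent_seq X ->
  identically_distributed X ->
  (exists S : probability R R,
     has_charfun S (fun t => expR (- (`|t| `^ alpha))) /\
     conv_in_distr P
       (fun n w => (n%:R `^ alpha^-1)^-1 * \sum_(i < n) X i w) S) ->
  (forall n, measurable_fun setT (N n)) ->
  (forall n, indep_of_seq (N n) X) ->
  (forall n, (2 <= n)%N -> is_negbin P (N n) nu (n%:R^-1)) ->
  exists L : probability R R,
    has_charfun L (fun t => (1 + `|t| `^ alpha) `^ (- nu)) /\
    conv_in_distr P
      (fun n w => (n%:R `^ alpha^-1)^-1 * \sum_(i < N n w) X i w) L.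
Proof.
move=> alpha0 _ nu0 _ _ [S [Schar XS]] mN NX Nnegbin.
have [W [g [mg g_gt0 laplaceE]]] := gamma_law_exists nu0.
have mga : measurable_fun setT (fun u => g u `^ alpha^-1).
  by apply: (@measurableT_comp _ _ _ _ _ _ (@powR R ^~ alpha^-1)).
have [L LE] := scale_mixture W S mga.
exists L; split=> [t|f cf [M fM]]; last first.
  rewrite (LE f M)//; last exact: continuous_measurable_fun.
  exact: (cvg_random_sum mg g_gt0 laplaceE XS mN NX Nnegbin cf fM).
have ga u : `|t * g u `^ alpha^-1| `^ alpha = `|t| `^ alpha * g u.
  rewrite normrM (ger0_norm (powR_ge0 _ _)) powRM ?powR_ge0// -powRrM mulVf ?gt_eqF//.
  by rewrite powRr1// ltW.
split.
- rewrite (LE (fun x => cos (t * x)) 1).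
  + under eq_integral => u _.
      under eq_integral do rewrite mulrA.
      rewrite (Schar (t * g u `^ alpha^-1)).1 ga; over.
    by rewrite laplaceE// powR_ge0.
  + apply: measurableT_comp; last exact: mulrl_measurable.
    by apply: continuous_measurable_fun; exact: continuous_cos.
  + by move=> x; rewrite ler_norml cos_geN1 cos_le1.
- rewrite (LE (fun x => sin (t * x)) 1).
  + under eq_integral => u _.
      under eq_integral do rewrite mulrA.
      rewrite (Schar (t * g u `^ alpha^-1)).2; over.
    by rewrite integral0.
  + apply: measurableT_comp; last exact: mulrl_measurable.
    by apply: continuous_measurable_fun; exact: continuous_sin.
  + by move=> x; rewrite ler_norml sin_geN1 sin_le1.
Qed.
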